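(* Let $w$ be a standard Sturmian word starting with the letter $a$, and let $(u_n)_{n\ge -1}$ be its associated sequence. Let $vz$, with $z\in\Sigma$, be a prefix of $w$. Then: 1. $v$ is open and $vz$ is closed if and only if there exists $n\ge 1$ such that $v=u_nxyu_n$; 2. $v$ is closed and $vz$ is open if and only if there exists $n\ge 0$ such that $v=u_nxyu_{n+1}=u_{n+1}yxu_n$. Here, for each $n$, $x$ and $y$ are the letters with $xy=ab$ if $n$ is odd and $xy=ba$ if $n$ is even.
   Context: Let $\Sigma=\{a,b\}$. Let $\alpha$ be irrational with $0<\alpha<1$ and continued fraction expansion $[0;d_0+1,d_1,d_2,\ldots]$ (so $d_0\ge 0$ and $d_n\ge 1$ for $n\ge 1$). Define $s_{-1}=b$, $s_0=a$, $s_{n+1}=s_n^{d_n}s_{n-1}$ for $n\ge 0$. The sequence $(s_n)_{n\ge -1}$ is a standard sequence; it converges to an infinite word $w=w_\alpha$, the standard Sturmian word of slope $\alpha$. It starts with $a$ if and only if $d_0>0$. For $n\ge -1$, $u_n$ is the element of the free group on $\Sigma$ defined by $s_n=u_nxy$, where $xy=ab$ if $n$ is odd and $xy=ba$ if $n$ is even. Thus $u_{-1}=a^{-1}$, $u_0=b^{-1}$, and (when $d_0>0$) $u_n\in\Sigma^*$ for $n\ge 1$. Products involving $u_n$ are computed in the free group; it is known that $u_nxyu_{n+1}=u_{n+1}yxu_n$. A finite word $w$ is closed if it is empty or has a factor $v\neq w$ (possibly empty) occurring exactly twice in $w$, once as a prefix and once as a suffix (the two occurrences may overlap; the empty word has $|w|+1$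 occurrences in $w$). A word that is not closed is open. *)

(* Defs.v *)
From HB Require Import structures.
From mathcomp Require Import all_boot all_order all_algebra.
From mathcomp Require Import reals.

Set Implicit Arguments.
Unset Strict Implicit.
Unset Printing Implicit Defensive.

Import Order.TTheory GRing.Theory Num.Theory.

Section FreeGroup.
Variable A : choiceType.

(* Elements of the free group are represented by reduced words of signed letters:
   (c, false) stands for the generator c and (c, true) for its inverse. *)
Definition slet : Type := (A * bool)%type.
HB.instance Definition _ := Choice.on slet.

Definition slet_inv (l : slet) : slet := (l.1, ~~ l.2).

Definition reduced (t : seq slet) : bool :=
  sorted (fun l m => m != slet_inv l) t.

Record free_group := FreeGroup {
  fg_val :> seq slet;
  fg_reduced : reduced fg_val }.

HB.instance Definition _ := [isSub for fg_val].
HB.instance Definition _ := [Choice of free_group by <:].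

Definition fg_push (l : slet) (t : seq slet) : seq slet :=
  if t is m :: t' then if m == slet_inv l then t' else l :: t else [:: l].

Definition fg_inv_val (t : seq slet) : seq slet := rev (map slet_inv t).

Lemma slet_invK : involutive slet_inv.
Proof. by case=> c e; rewrite /slet_inv /= negbK. Qed.

Lemma reduced_tail l t : reduced (l :: t) -> reduced t.
Proof. exact: path_sorted. Qed.

Lemma fg_push_reduced l t : reduced t -> reduced (fg_push l t).
Proof.
case: t => [//|m t] /= Ht; case: ifP => [_|/negbT Hml].
  exact: path_sorted Ht.
by rewrite /= Hml.
Qed.

Lemma fg_foldr_reduced s t : reduced t -> reduced (foldr fg_push t s).
Proof. by move=> Ht; elim: s => //= l s; apply: fg_push_reduced. Qed.

Lemma fg_pushK l t : reduced t -> fg_push l (fg_push (slet_inv l) t) = t.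
Proof.
case: t => [_|m t] /=; first by rewrite eqxx.
rewrite slet_invK; case: eqP => [-> | _ _] /=; last by rewrite eqxx.
by case: t => //= n t /andP[/negbTE -> _].
Qed.

Lemma fg_foldr_push l s t : reduced t ->
  foldr fg_push t (fg_push l s) = fg_push l (foldr fg_push t s).
Proof.
move=> Ht; case: s => [//|m s] /=.
by case: eqP => [->|//]; rewrite fg_pushK // fg_foldr_reduced.
Qed.

Lemma fg_foldr_id t : reduced t -> foldr fg_push [::] t = t.
Proof.
elim: t => //= l t IH Ht; rewrite IH; last exact: reduced_tail Ht.
by case: t Ht {IH} => //= m t /andP[/negbTE -> _].
Qed.

Lemma fg_inv_reduced t : reduced t -> reduced (fg_inv_val t).
Proof.
rewrite /reduced /fg_inv_val rev_sorted sorted_map.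
apply: sub_sorted => l m /=; apply: contra => /eqP ->.
by rewrite slet_invK.
Qed.

Lemma fg_foldr_inv s t : reduced t ->
  foldr fg_push (foldr fg_push t s) (fg_inv_val s) = t.
Proof.
move=> Ht; elim: s => [//|l s IH].
rewrite /fg_inv_val /= rev_cons -cats1 foldr_cat /= -[in X in fg_push _ X](slet_invK l).
by rewrite fg_pushK ?fg_foldr_reduced.
Qed.

Definition fg_one : free_group := @FreeGroup [::] isT.
Definition fg_inv (g : free_group) : free_group :=
  FreeGroup (fg_inv_reduced (fg_reduced g)).
Definition fg_mul (g h : free_group) : free_group :=
  FreeGroup (fg_foldr_reduced g (fg_reduced h)).

Lemma fg_mulA : associative fg_mul.
Proof.
move=> [s Hs] [t Ht] [r Hr]; apply: val_inj => /= {Hs}.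
by elim: s => //= l s ->; rewrite fg_foldr_push.
Qed.

Lemma fg_mul1g : left_id fg_one fg_mul.
Proof. by move=> g; apply: val_inj. Qed.

Lemma fg_mulg1 : right_id fg_one fg_mul.
Proof. by case=> t Ht; apply: val_inj; apply: fg_foldr_id. Qed.

Lemma fg_mulVg : left_inverse fg_one fg_inv fg_mul.
Proof.
case=> t Ht; apply: val_inj => /=.
by rewrite -[X in foldr _ X](fg_foldr_id Ht) fg_foldr_inv.
Qed.

Lemma fg_invK : involutive fg_inv.
Proof.
case=> t Ht; apply: val_inj => /=.
by rewrite /fg_inv_val map_rev revK mapK //; apply: slet_invK.
Qed.

Lemma fg_mulgV : right_inverse fg_one fg_inv fg_mul.
Proof. by move=> g; rewrite -{1}(fg_invK g) fg_mulVg. Qed.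

HB.instance Definition _ :=
  isGroup.Build free_group fg_mulA fg_mul1g fg_mulg1 fg_mulVg fg_mulgV.

Definition gen (c : A) : free_group := @FreeGroup [:: (c, false)] isT.

Definition of_word (v : seq A) : free_group := (\prod_(c <- v) gen c)%g.

Lemma of_word_val v : of_word v = [seq (c, false) | c <- v] :> seq slet.
Proof.
rewrite /of_word; elim: v => [|c v IH]; first by rewrite big_nil.
rewrite big_cons /= IH; case: v {IH} => //= e v.
by rewrite /slet_inv xpair_eqE andbF.
Qed.

Lemma of_word_inj : injective of_word.
Proof.
move=> v v' /(congr1 fg_val); rewrite !of_word_val.
by apply: inj_map => c e [].
Qed.

End FreeGroup.

Section Closed.
Variable A : eqType.
Implicit Types v w : seq A.

(* The range of positions includes [size w], so that the empty word has
   [(size w).+1] occurrences in [w]. *)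
Definition occurrences v w : nat :=
  count (fun i => prefix v (drop i w)) (iota 0 (size w).+1).

Definition closed_word w : Prop :=
  w = [::] \/
  exists v, [/\ v <> w, occurrences v w = 2, prefix v w & suffix v w].

Definition open_word w : Prop := ~ closed_word w.

End Closed.

Definition prefix_of (A : Type) (v : seq A) (w : nat -> A) : Prop :=
  v = mkseq w (size v).

Definition converges_to (A : Type) (s : nat -> seq A) (w : nat -> A) : Prop :=
  forall k, exists N, forall n, N <= n -> onth (s n) k = Some (w k).

Section ContinuedFraction.
Variable R : realType.
Implicit Type alpha : R.
Local Open Scope ring_scope.

(* Iterates of the Gauss map t |-> 1/t - floor(1/t), starting from [alpha]. *)
Fixpoint gauss_iter alpha (n : nat) : R :=
  if n is m.+1 then
    let t := (gauss_iter alpha m)^-1 in t - (Num.truncn t)%:R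
  else alpha.

Definition partial_quotient alpha (n : nat) : nat :=
  Num.truncn (gauss_iter alpha n)^-1.

(* alpha = [0; d_0 + 1, d_1, d_2, ...] *)
Definition cf_expansion alpha (d : nat -> nat) : Prop :=
  partial_quotient alpha 0 = (d 0%N).+1 /\
  forall n, partial_quotient alpha n.+1 = d n.+1.

End ContinuedFraction.

Variant letter : Type := la | lb.

Definition bool_of_letter (c : letter) : bool := if c is la then true else false.
Definition letter_of_bool (e : bool) : letter := if e then la else lb.
Lemma bool_of_letterK : cancel bool_of_letter letter_of_bool.
Proof. by case. Qed.
HB.instance Definition _ := Countable.copy letter (can_type bool_of_letterK).

(* The pair (s_(n-1), s_n), starting from (s_(-1), s_0) = (b, a); [std] gives s_n
   for n >= 0 only. *)
Fixpoint std_pair (d : nat -> nat) (n : nat) : seq letter * seq letter :=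
  if n is m.+1 then
    let: (p, q) := std_pair d m in (q, flatten (nseq (d m) q) ++ p)
  else ([:: lb], [:: la]).

Definition std (d : nat -> nat) (n : nat) : seq letter := (std_pair d n).2.

Definition standard_sturmian (R : realType) (alpha : R) (d : nat -> nat)
    (w : nat -> letter) : Prop :=
  [/\ (0 < alpha < 1)%R, irrational alpha, cf_expansion alpha d
    & converges_to (std d) w].

Definition lx (n : nat) : letter := if odd n then la else lb.
Definition ly (n : nat) : letter := if odd n then lb else la.

(* The solution u_n of s_n = u_n x y in the free group; e.g. u_0 = b^-1. *)
Definition u (d : nat -> nat) (n : nat) : free_group letter :=
  (of_word (std d n) / of_word [:: lx n; ly n])%g.

Lemma std_u d n : of_word (std d n) = (u d n * gen (lx n) * gen (ly n))%g.
Proof.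
by rewrite -mulgA /u /of_word !big_cons big_nil /= Monoid.mulm1 divgK.
Qed.

(* Main.v *)
Require Import Defs.
From mathcomp Require Import all_boot all_order all_algebra.
From mathcomp Require Import reals.
From mathcomp Require Import zify.

(* Let q_n = |s_n|.  A nonempty prefix of w of length k is closed iff
   2 q_n - 1 <= k <= q_n + q_(n+1) - 2 for some n >= 0, and open iff
   q_n + q_(n+1) - 1 <= k <= 2 q_(n+1) - 2 for some n >= 0; these ranges
   alternate, and the words of the theorem are the prefixes at their right ends.
   As s_n s_(n+1) and s_(n+1) s_n differ only in their last two letters, the
   prefix of length q_n + q_(n+1) - 2 has period q_n.  Since s_n is primitive
   (q_n and |s_n|_a are coprime, by the determinant identity), Fine and Wilf's
   theorem forbids a period p < q_n on length p + q_n - 1: in the closed range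
   the border of length k - q_n thus has no occurrence strictly between 0 and q_n.
   In the open range, the same argument shows that the border of a closed prefix
   is shorter than q_(n+1) - 1, but then it also occurs at position q_n. *)

Set Implicit Arguments.
Unset Strict Implicit.
Unset Printing Implicit Defensive.

(** * Periods of prefixes and the theorem of Fine and Wilf *)

Definition has_period (A : Type) (w : nat -> A) (p L : nat) : Prop :=
  forall j, j + p < L -> w (j + p) = w j.

Lemma has_periodW (A : Type) (w : nat -> A) p L L' :
  L' <= L -> has_period w p L -> has_period w p L'.
Proof. by move=> leL per j jL; apply: per; apply: leq_trans leL. Qed.

Lemma has_periodP (A : Type) (w : nat -> A) p L :
  has_period w p L <-> forall j, j < L -> w j = w (j %% p).
Proof.
split=> [per j jL|modw j jL]; last first.
  by rewrite modw // modnDr -modw //; lia.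
suff addM k : j %% p + k * p < L -> w (j %% p + k * p) = w (j %% p).
  by rewrite {1}(divn_eq j p) addnC addM // addnC -divn_eq.
elim: k => [|k IH] kL; first by rewrite addn0.
by rewrite mulSnr addnA per ?IH //; lia.
Qed.

(** Positions reduce modulo [p] into the first block, then modulo [g]; the two reductions compose
    because [g] divides [p]. *)
Lemma has_period_dvd (A : Type) (w : nat -> A) g p L :
  g %| p -> 0 < p <= L -> has_period w g p -> has_period w p L ->
  has_period w g L.
Proof.
move=> gp /andP[p0 pL] /has_periodP perg /has_periodP perp.
apply/has_periodP => j jL.
by rewrite perp // perg ?ltn_pmod // modn_dvdm.
Qed.

(** Euclid's algorithm by subtraction: for [p < q] the prefix of length [L - p] has periods [p] and
    [q - p], and it still contains a full block of length [p], from which the gcd spreads to length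
    [L]. *)
Lemma fine_wilf (A : Type) (w : nat -> A) p q L :
  0 < p -> 0 < q -> p + q <= L.+1 ->
  has_period w p L -> has_period w q L -> has_period w (gcdn p q) L.
Proof.
have [m] := ubnP (p + q); elim: m p q L => // m IH p q L.
wlog le_pq : p q / p <= q => [sym ltm p0 q0 pqL perp perq|].
  have [/sym|/ltnW/sym symq] := leqP p q; first exact.
  by rewrite gcdnC; apply: symq; rewrite // addnC.
move=> ltm p0 q0 pqL perp perq.
have [<-|neq_pq] := eqVneq p q; first by rewrite gcdnn.
have lt_pq : p < q by lia.
apply: (@has_period_dvd _ _ _ p) => //; first exact: dvdn_gcdl.
  by lia.
apply: (@has_periodW _ _ _ (L - p)); first by lia.
have -> : gcdn p q = gcdn p (q - p).
  by rewrite -{1}(subnKC le_pq) gcdnDl.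
apply: IH; try lia.
  by apply: has_periodW perp; lia.
move=> j jL; rewrite -perp; last by lia.
by rewrite -addnA subnK // perq //; lia.
Qed.

(** * Closed prefixes in terms of periods *)

Lemma nth_take_drop_mkseq (A : eqType) (w : nat -> A) (k m i j : nat) x0 :
  i + m <= k -> j < m -> nth x0 (take m (drop i (mkseq w k))) j = w (i + j).
Proof. by move=> imk jm; rewrite nth_take // nth_drop nth_mkseq //; lia. Qed.

Lemma prefix_drop_mkseq (A : eqType) (w : nat -> A) k m i :
  i <= k -> m <= k ->
  prefix (mkseq w m) (drop i (mkseq w k)) <->
  i + m <= k /\ has_period w i (i + m).
Proof.
move=> ik mk; rewrite prefixE size_mkseq; split=> [/eqP eqw|[imk per]].
  have imk : i + m <= k.
    by move/(congr1 size): eqw; rewrite size_take_min size_drop !size_mkseq; lia.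
  split=> // j jL; have jm : j < m by lia.
  rewrite addnC -(@nth_take_drop_mkseq _ w k m i j (w 0)) // eqw.
  by rewrite nth_mkseq.
apply/eqP/(@eq_from_nth _ (w 0)).
  by rewrite size_take_min size_drop !size_mkseq; lia.
move=> j; rewrite size_take_min size_drop size_mkseq => jm.
have {}jm : j < m by lia.
by rewrite nth_take_drop_mkseq // nth_mkseq // addnC per //; lia.
Qed.

(** Here [p] is the position of the last occurrence of the border, whose length is then [k - p]. By
    [prefix_drop_mkseq], an inner occurrence at [i] is a period [i] on length [i + (k - p)]. *)
Lemma closed_mkseqP (A : eqType) (w : nat -> A) k :
  closed_word (mkseq w k) <->
  k = 0 \/
  exists p, [/\ 0 < p, p <= k, has_period w p k
              & forall i, 0 < i < p -> ~ has_period w i (i + (k - p))].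
Proof.
have memE m i : i \in [seq i <- iota 0 k.+1
    | prefix (mkseq w m) (drop i (mkseq w k))] =
    (prefix (mkseq w m) (drop i (mkseq w k))) && (i <= k).
  by rewrite mem_filter mem_iota add0n ltnS.
split=> [[/(congr1 size)|[v [vw occ pre suf]]]|[->|[p [p0 pk per noper]]]].
- by rewrite size_mkseq => ?; left.
- right; have mk : size v <= k by have := size_prefix pre; rewrite size_mkseq.
  have vE : v = mkseq w (size v).
    move: pre; rewrite prefixE => /eqP {1}<-.
    by rewrite /mkseq -map_take take_iota (minn_idPl mk).
  have mlt : size v < k.
    rewrite ltn_neqAle mk andbT; apply/eqP => mE; apply: vw.
    by rewrite vE mE.
  have sufp : prefix v (drop (k - size v) (mkseq w k)).
    by move: suf; rewrite suffixE size_mkseq => /eqP ->; rewrite prefix_refl.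
  have := sufp; rewrite {1}vE => /prefix_drop_mkseq; case; try lia.
  move=> _; rewrite subnK // => per.
  exists (k - size v); split=> //; try lia.
  move=> i /andP[i0 ip]; rewrite subKn // => peri.
  (* With [i] the border would have three distinct occurrences. *)
  have : size [:: 0; i; k - size v] <= 2.
    rewrite -occ /occurrences -size_filter size_mkseq; apply: uniq_leq_size.
      by rewrite /= !inE; lia.
    move=> j; rewrite !inE vE memE => /or3P[] /eqP->.
    + by rewrite drop0 -vE pre.
    + rewrite andbC; apply/andP; split; first by lia.
      by apply/prefix_drop_mkseq; [lia..|split=> //; lia].
    + by rewrite -vE sufp leq_subr.
  by [].
- by left.
- right; exists (mkseq w (k - p)); split.
  + by move/(congr1 size); rewrite !size_mkseq; lia.
  + rewrite /occurrences -size_filter size_mkseq.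
    apply/eqP; have -> : 2 = size [:: 0; p] by [].
    apply/eqP/perm_size/uniq_perm.
    * by rewrite filter_uniq // iota_uniq.
    * by rewrite /= !inE; lia.
    move=> i; rewrite memE !inE; apply/andP/orP.
      move=> [/prefix_drop_mkseq H ik]; have [||ikp peri] := H; try lia.
      have [->|i0] := posnP i; first by left.
      right; have [ip|pi|//] := ltngtP i p; last by lia.
      by case: (noper i); rewrite ?i0.
    case=> /eqP ->; split=> //; apply/prefix_drop_mkseq => //; try lia.
      by split; [lia|move=> j _; rewrite addn0].
    by split; [lia|rewrite subnKC].
  + have := @prefix_drop_mkseq _ w k (k - p) 0 isT (leq_subr _ _).
    rewrite drop0 => -[_]; apply.
    by split; [lia|move=> j _; rewrite addn0].
  + rewrite suffixE !size_mkseq subKn //.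
    have [_] := @prefix_drop_mkseq _ w k (k - p) p pk (leq_subr _ _).
    rewrite prefixE size_mkseq take_oversize; last first.
      by rewrite size_drop size_mkseq.
    by apply; split; [lia|rewrite subnKC].
Qed.

(** * Recursion and near-commutation of the standard words *)

Lemma std_pairE d n : std_pair d n.+1 = (std d n, std d n.+1).
Proof. by rewrite /std /=; case: (std_pair d n). Qed.

Lemma std1E d : std d 1 = rcons (nseq (d 0) la) lb.
Proof. by rewrite /std /= cats1; congr rcons; elim: (d 0) => //= m ->. Qed.

Lemma stdSS d n :
  std d n.+2 = flatten (nseq (d n.+1) (std d n.+1)) ++ std d n.
Proof. by rewrite {1}/std [std_pair _ n.+2]/= -/(std_pair d n.+1) std_pairE. Qed.

Lemma size_flatten_nseq (A : Type) k (s : seq A) :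
  size (flatten (nseq k s)) = k * size s.
Proof. by rewrite size_flatten /shape map_nseq sumn_nseq mulnC. Qed.

Lemma count_flatten_nseq (A : Type) (P : pred A) k (s : seq A) :
  count P (flatten (nseq k s)) = k * count P s.
Proof. by elim: k => //= k; rewrite count_cat mulSn => ->. Qed.

Lemma flatten_nseq_comm (A : Type) k (s : seq A) :
  s ++ flatten (nseq k s) = flatten (nseq k s) ++ s.
Proof. by elim: k => [|k IH] /=; rewrite ?cats0 // -catA -IH. Qed.

Lemma lxS n : lx n.+1 = ly n. Proof. by rewrite /lx /ly /=; case: odd. Qed.
Lemma lyS n : ly n.+1 = lx n. Proof. by rewrite /lx /ly /=; case: odd. Qed.

(* [t] is the central word u_n x y u_(n+1) = u_(n+1) y x u_n. *)
Lemma std_near_comm d n :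
  exists t, std d n ++ std d n.+1 = t ++ [:: ly n; lx n] /\
            std d n.+1 ++ std d n = t ++ [:: lx n; ly n].
Proof.
elim: n => [|n [t [E1 E2]]].
  exists (nseq (d 0) la); rewrite std1E -cats1 -!catA; split=> //=.
  by rewrite -[la :: _]/(nseq (d 0).+1 la ++ [:: lb]) -addn1 nseqD -catA.
(* The power of s_(n+1) commutes with s_(n+1), so it can be moved in front of both products; the two
   identities for [n] then exchange roles. *)
exists (flatten (nseq (d n.+1) (std d n.+1)) ++ t).
rewrite lxS lyS stdSS -!catA -E1 -E2; split=> //.
by rewrite !catA flatten_nseq_comm.
Qed.

(** * Lengths and letter counts of the standard words *)

Section Positive.
Variable d : nat -> nat.
Hypothesis d_gt0 : forall n, 0 < d n.

Let q n := size (std d n).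

Lemma prefix_stdS n : prefix (std d n) (std d n.+1).
Proof.
case: n => [|n]; first by rewrite std1E /std -(prednK (d_gt0 0)) /= prefix0s.
rewrite stdSS; case: (d n.+1) (d_gt0 n.+1) => // k _ /=.
by rewrite -catA prefix_prefix.
Qed.

Lemma prefix_std m n : m <= n -> prefix (std d m) (std d n).
Proof.
elim: n => [|n IH]; first by rewrite leqn0 => /eqP ->; apply: prefix_refl.
rewrite leq_eqVlt => /predU1P[->|/IH mn]; first exact: prefix_refl.
exact: prefix_trans mn (prefix_stdS n).
Qed.

Lemma size_std_gt0 n : 0 < q n.
Proof. by have /size_prefix := prefix_std (leq0n n). Qed.

Lemma size_std_lt n : q n < q n.+1.
Proof.
rewrite /q; case: n => [|n].
  by rewrite std1E size_rcons size_nseq ltnS d_gt0.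
have := size_std_gt0 n; rewrite stdSS size_cat size_flatten_nseq /q.
by have := d_gt0 n.+1; nia.
Qed.

(** For [n >= 1], u_n is thus a genuine word: s_n has length at least 2 and ends the product s_(n-1)
    s_n, whose last two letters are known. *)
Lemma std_suffix n : 0 < n ->
  exists t, std d n = t ++ [:: lx n; ly n].
Proof.
case: n => // n _; have [t [E _]] := std_near_comm d n.
have qS := size_std_lt n; have q0 := size_std_gt0 n.
have E2 := congr1 (drop (q n)) E; rewrite drop_size_cat // in E2.
exists (drop (q n) t); rewrite E2 drop_cat lxS lyS.
have := congr1 size E; rewrite !size_cat /= -/(q n) -/(q n.+1) => sE.
case: ltnP => // qt; have -> : size t = q n by lia.
by rewrite subnn drop0 drop_oversize //; lia.
Qed.

(** The determinant of lengths and letter counts is 1 or -1, and each recursion step flips its sign;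
    the disjunction avoids subtraction in [nat]. *)
Lemma std_det n : let c m := count_mem la (std d m) in
  q n * c n.+1 = (q n.+1 * c n).+1 \/ q n.+1 * c n = (q n * c n.+1).+1.
Proof.
elim: n => [|n IH] c.
  right; rewrite /q /c std1E -cats1 count_cat size_cat size_nseq.
  by rewrite count_nseq /std /=; lia.
have qE : q n.+2 = d n.+1 * q n.+1 + q n.
  by rewrite /q stdSS size_cat size_flatten_nseq.
have cE : c n.+2 = d n.+1 * c n.+1 + c n.
  by rewrite /c stdSS count_cat count_flatten_nseq.
rewrite qE cE mulnDr mulnDl mulnCA mulnA.
by case: IH; rewrite -/(c n) -/(c n.+1) => ?; [right|left]; lia.
Qed.

Lemma coprime_std n : coprime (q n) (count_mem la (std d n)).
Proof.
set c := count_mem la; rewrite /coprime -dvdn1.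
set g := gcdn _ _.
have gq : g %| q n by apply: dvdn_gcdl.
have gc : g %| c (std d n) by apply: dvdn_gcdr.
case: (std_det n); rewrite -/c => E.
  have : g %| (q n.+1 * c (std d n)).+1 by rewrite -E dvdn_mulr.
  by rewrite -addn1 dvdn_addr // dvdn_mull.
have : g %| (q n * c (std d n.+1)).+1 by rewrite -E dvdn_mull.
by rewrite -addn1 dvdn_addr // dvdn_mulr.
Qed.

(** * Prefixes and periods of the limit word *)

Section Limit.
Variable w : nat -> letter.
Hypothesis w_lim : converges_to (std d) w.

Lemma std_mkseq n : std d n = mkseq w (q n).
Proof.
apply: (@eq_from_nth _ la); first by rewrite size_mkseq.
move=> k kq; rewrite nth_mkseq //.
have [N wN] := w_lim k.
rewrite -(onth_nth la _ _ _ (wN (maxn N n) (leq_maxl _ _))).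
have /prefixP[t ->] := prefix_std (leq_maxr N n).
by rewrite nth_cat -/(q n) kq.
Qed.

Lemma nth_std n k : k < q n -> nth la (std d n) k = w k.
Proof. by move=> kq; rewrite std_mkseq nth_mkseq. Qed.

(** The word s_(n+2) starts with s_(n+1), and what follows starts with s_n, either directly or
    because s_n is a prefix of s_(n+1). *)
Lemma nth_stdS_std n k : k < q n.+1 + q n ->
  nth la (std d n.+1 ++ std d n) k = w k.
Proof.
move=> kq; suff : prefix (std d n.+1 ++ std d n) (std d n.+3).
  move=> /prefixP[t E]; rewrite -(@nth_std n.+3) ?E.
    by rewrite [RHS]nth_cat size_cat -/(q n) -/(q n.+1) kq.
  by rewrite /q E 2!size_cat -/(q n) -/(q n.+1); lia.
have /prefixP[t1 ->] := prefix_stdS n.+2.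
rewrite stdSS; case: (d n.+1) (d_gt0 n.+1) => // k' _ /=.
have /prefixP[t2 E2] : prefix (std d n) (flatten (nseq k' (std d n.+1)) ++ std d n).
  case: k' => [|k'] /=; first exact: prefix_refl.
  by have /prefixP[t2 ->] := prefix_stdS n; rewrite -!catA prefix_prefix.
by rewrite -(catA (std d n.+1)) E2 -!catA catA prefix_prefix.
Qed.

Lemma std_central n :
  std d n ++ std d n.+1 = mkseq w (q n + q n.+1 - 2) ++ [:: ly n; lx n] /\
  std d n.+1 ++ std d n = mkseq w (q n + q n.+1 - 2) ++ [:: lx n; ly n].
Proof.
have [t [E1 E2]] := std_near_comm d n.
suff <- : t = mkseq w (q n + q n.+1 - 2) by [].
have := congr1 size E2; rewrite !size_cat /= -/(q n) -/(q n.+1) => sE.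
apply: (@eq_from_nth _ la); first by rewrite size_mkseq; lia.
move=> k kt; rewrite nth_mkseq; last by lia.
by rewrite -(@nth_stdS_std n) ?E2 ?nth_cat ?kt //; lia.
Qed.

Lemma has_period_std n : has_period w (q n) (q n + q n.+1 - 2).
Proof.
move=> j jq; have [E1 _] := std_central n.
(* On the left this letter lies in s_(n+1), at position [j]; on the right it lies in the central
   prefix. *)
have := congr1 (nth la ^~ (j + q n)) E1.
rewrite !nth_cat size_mkseq jq -/(q n) ltnNge leq_addl /= addnK.
by rewrite nth_mkseq // => <-; rewrite nth_std //; lia.
Qed.

(** This identifies u_n x y u_n as a prefix of [w]: as [q n < q n.+1], its length stays within the
    range where [q n] is a period. *)
Lemma std_square n : 0 < n ->
  std d n ++ std d n = mkseq w (2 * q n - 2) ++ [:: lx n; ly n].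
Proof.
move=> n0; have [t E] := std_suffix n0.
rewrite [X in _ ++ X]E catA; congr (_ ++ _).
have qE : q n = size t + 2 by rewrite /q E size_cat.
apply: (@eq_from_nth _ la); first by rewrite size_cat size_mkseq -/(q n); lia.
move=> k; rewrite size_cat -/(q n) => kt; rewrite nth_mkseq; last by lia.
have qS := size_std_lt n.
rewrite nth_cat -/(q n); case: ltnP => kq; first exact: nth_std.
rewrite -{2}(subnK kq) has_period_std; last by lia.
by rewrite -(@nth_std n) ?E ?nth_cat; [case: ltnP => //|]; lia.
Qed.

(** If s_n were an [m]-th power, [m] would divide both its length and its number of letters [la], so
    [m = 1] by coprimality. *)
Lemma std_primitive n g : 0 < g < q n -> g %| q n -> ~ has_period w g (q n).
Proof.
move=> /andP[g0 gq] /dvdnP[m qE] /has_periodP per.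
have sE : std d n = flatten (nseq m (mkseq w g)).
  rewrite std_mkseq qE; apply: (@eq_from_nth _ la).
    by rewrite size_flatten_nseq !size_mkseq.
  move=> k; rewrite size_mkseq => kq; rewrite nth_mkseq //.
  rewrite per ?qE // {per qE gq}.
  elim: m k kq => //= m IH k kq.
  rewrite nth_cat size_mkseq; case: ltnP => kg.
    by rewrite nth_mkseq // modn_small.
  rewrite -IH; last by lia.
  by rewrite -{1}(subnK kg) modnDr.
have := coprime_std n; rewrite /q sE count_flatten_nseq size_flatten_nseq.
rewrite coprimeMl => /andP[]; rewrite coprimeMr => /andP[].
by rewrite /coprime gcdnn => /eqP m1; lia.
Qed.

Lemma std_no_short_period n p :
  0 < p < q n -> ~ has_period w p (p + q n - 1).
Proof.
move=> /andP[p0 pq] per; have qS := size_std_lt n.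
(* The length fits because [p < q n < q n.+1]. *)
have perq : has_period w (q n) (p + q n - 1).
  by apply: has_periodW (@has_period_std n); lia.
have := fine_wilf p0 (size_std_gt0 n) _ per perq.
rewrite -/(q n) => /(_ _) perg.
apply: (@std_primitive n (gcdn p (q n))).
- by rewrite gcdn_gt0 p0 /=; apply: leq_ltn_trans pq; apply: dvdn_leq (dvdn_gcdl _ _).
- exact: dvdn_gcdr.
- by apply: has_periodW (perg _); lia.
Qed.

(** * Closed and open ranges of lengths *)

Lemma closed_range n k : 2 * q n - 1 <= k <= q n + q n.+1 - 2 ->
  closed_word (mkseq w k).
Proof.
move=> /andP[k1 k2]; have q0 := size_std_gt0 n.
apply/closed_mkseqP; right; exists (q n); split; try lia.
  exact: has_periodW k2 (@has_period_std n).
move=> i iq per; apply: (std_no_short_period iq).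
(* The lower bound on [k] leaves a border of length at least [q n - 1], as the forbidden length
   [i + q n - 1] requires. *)
by apply: has_periodW per; lia.
Qed.

Lemma open_range n k : q n + q n.+1 - 1 <= k <= 2 * q n.+1 - 2 ->
  open_word (mkseq w k).
Proof.
move=> /andP[k1 k2]; have q0 := size_std_gt0 n; have qS := size_std_lt n.
move/closed_mkseqP => [?|[p [p0 pk per noper]]]; first by lia.
(* A border of length at least [q n.+1 - 1] forces [p < q n.+1], a forbidden period; a smaller one
   forces [q n < p] and recurs at [q n]. *)
have [short|long] := leqP (q n.+1 - 1) (k - p).
  apply: (@std_no_short_period n.+1 p); first by lia.
  by apply: has_periodW per; lia.
apply: (noper (q n)); first by lia.
by apply: has_periodW (@has_period_std n); lia.
Qed.

Lemma range_cover k : 0 < k -> exists n,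
  2 * q n - 1 <= k <= q n + q n.+1 - 2 \/
  q n + q n.+1 - 1 <= k <= 2 * q n.+1 - 2.
Proof.
elim: k => // k IH _; have [->|k0] := posnP k.
  exists 0; left; have := d_gt0 0.
  by rewrite /q std1E size_rcons size_nseq /std /=; lia.
have [n kn] := IH k0; have := size_std_lt n; have := size_std_lt n.+1.
(* Only the end of an open range moves on to the next index. *)
have [] := ltnP k (2 * q n.+1 - 2); last by exists n.+1; lia.
by exists n; lia.
Qed.

(** The bound [0 < n] excludes the length [2 * q 0 - 2 = 0]: the empty word is closed. *)
Lemma open_closedP k :
  open_word (mkseq w k) /\ closed_word (mkseq w k.+1) <->
  exists2 n, 0 < n & k = 2 * q n - 2.
Proof.
split=> [[opk clk]|[[//|n] _ ->]].
  have [k0|k0] := posnP k; first by case: opk; rewrite k0; left.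
  have [n [kC|kO]] := range_cover k0; first by case: opk; apply: closed_range kC.
  exists n.+1 => //; have [kS|] := ltnP k (2 * q n.+1 - 2); last by lia.
  by case: (@open_range n k.+1) => //; lia.
have := size_std_lt n.+1; have := size_std_lt n; have := size_std_gt0 n.
by split; [apply: (@open_range n)|apply: (@closed_range n.+1)]; lia.
Qed.

Lemma closed_openP k :
  closed_word (mkseq w k) /\ open_word (mkseq w k.+1) <->
  exists n, k = q n + q n.+1 - 2.
Proof.
split=> [[clk opk]|[n ->]].
  (* Locating [k.+1] rather than [k] spares a case for the empty prefix. *)
  have [n kn] := range_cover (ltn0Sn k).
  have {kn} [kC|kO] := kn; first by case: opk; apply: closed_range kC.
  exists n; have := size_std_lt n; have := size_std_gt0 n.
  have [kS|] := leqP (q n + q n.+1 - 1) k; last by lia.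
  by case: (@open_range n k) => //; lia.
have := size_std_lt n; have := size_std_gt0 n.
by split; [apply: (@closed_range n)|apply: (@open_range n)]; lia.
Qed.

End Limit.
End Positive.

(** * Translation to the free group *)

Lemma of_word_cat (A : choiceType) (s t : seq A) :
  of_word (s ++ t) = (of_word s * of_word t)%g.
Proof. exact: big_cat. Qed.

(** Multiplying on the right by the two letters removed from s_m leaves an equality of words, even
    when u_m is not a word. *)
Lemma of_word_std_uP d n m (v : seq letter) :
  of_word v = (u d n * gen (lx n) * gen (ly n) * u d m)%g <->
  v ++ [:: lx m; ly m] = std d n ++ std d m.
Proof.
rewrite -std_u /u mulgA -of_word_cat; split=> [vE|<-].
  by apply: (@of_word_inj letter); rewrite of_word_cat vE mulgVK.
by rewrite of_word_cat mulgK.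
Qed.

Lemma u_near_comm d n :
  (u d n * gen (lx n) * gen (ly n) * u d n.+1 =
   u d n.+1 * gen (ly n) * gen (lx n) * u d n)%g.
Proof.
have [t [E1 E2]] := std_near_comm d n.
transitivity (of_word t).
  by apply/esym/of_word_std_uP; rewrite lxS lyS.
by rewrite -(lxS n) -(lyS n); apply/of_word_std_uP; rewrite E2.
Qed.

(** * Positivity of the partial quotients *)

Section GaussMap.
Import Order.TTheory GRing.Theory Num.Theory.
Variables (R : realType) (alpha : R).
Local Open Scope ring_scope.

(** A Gauss step is undone by rational operations, so a rational iterate would make its predecessor
    rational. *)
Lemma gauss_iter_irrational : irrational alpha -> forall n, irrational (gauss_iter alpha n).
Proof.
move=> irr; elim=> //= n IH [r _ rE]; apply: IH.
exists (r + (Num.truncn (gauss_iter alpha n)^-1)%:R)^-1 => //.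
by rewrite fmorphV rmorphD /= ratr_nat rE subrK invrK.
Qed.

Lemma gauss_iter_itv : 0 < alpha < 1 -> irrational alpha ->
  forall n, 0 < gauss_iter alpha n < 1.
Proof.
move=> alpha01 irr; elim=> // n /andP[g0 g1].
have /(truncn_itv) /andP[le_tr tr_lt] : 0 <= (gauss_iter alpha n)^-1.
  by rewrite invr_ge0 ltW.
rewrite /= ltrBlDl natr1 tr_lt andbT.
rewrite lt_def subr_ge0 le_tr andbT.
apply/eqP => g_eq0; have := @gauss_iter_irrational irr n.+1.
by apply; exists 0 => //; rewrite rmorph0 /= g_eq0.
Qed.

Lemma partial_quotient_gt0 : 0 < alpha < 1 -> irrational alpha ->
  forall n, (0 < partial_quotient alpha n)%N.
Proof.
move=> alpha01 irr n; have /andP[g0 g1] := gauss_iter_itv alpha01 irr n.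
by rewrite truncn_gt0 invf_ge1 // ltW.
Qed.

End GaussMap.

Lemma standard_sturmian_gt0 (R : realType) (alpha : R) d w :
  standard_sturmian alpha d w -> w 0 = la -> forall n, 0 < d n.
Proof.
move=> [alpha01 irr [_ dE] lim] wa.
have dS n : 0 < d n.+1 by rewrite -dE partial_quotient_gt0.
case=> [|n]; last exact: dS.
rewrite lt0n; apply/eqP => d0.
(* If [d 0 = 0] then s_1 = b, and all later words, hence [w], start with b. *)
have stdb n : ohead (std d n.+1) = Some lb.
  elim: n => [|n]; first by rewrite std1E d0.
  by rewrite stdSS -(prednK (dS n)) /=; case: (std d n.+1).
have [N wN] := lim 0; have := wN N.+1 (leqnSn N).
by have := stdb N; case: (std d N.+1) => //= c s [->] []; rewrite wa.
Qed.

Theorem theorem17 (R : realType) (alpha : R) (d : nat -> nat)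
    (w : nat -> letter) (v : seq letter) (z : letter)
    (hw : standard_sturmian alpha d w) (hwa : w 0 = la)
    (hvz : prefix_of (rcons v z) w) :
  (open_word v /\ closed_word (rcons v z) <->
     exists n : nat, 1 <= n /\
       of_word v = (u d n * gen (lx n) * gen (ly n) * u d n)%g) /\
  (closed_word v /\ open_word (rcons v z) <->
     exists n : nat,
       of_word v = (u d n * gen (lx n) * gen (ly n) * u d n.+1)%g /\
       (u d n * gen (lx n) * gen (ly n) * u d n.+1)%g =
         (u d n.+1 * gen (ly n) * gen (lx n) * u d n)%g).
Proof.
have d_gt0 := standard_sturmian_gt0 hw hwa; have [_ _ _ lim] := hw.
have vE : v = mkseq w (size v).
  move: (hvz); rewrite /prefix_of size_rcons /mkseq -addn1 iotaD map_cat cats1.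
  by case/rcons_inj.
(* Since [v] is itself a prefix of [w], the word equations reduce to equations of lengths. *)
have prefE m e : v ++ e = mkseq w m ++ e <-> size v = m.
  split=> [/(congr1 size)|<-]; last by rewrite -vE.
  by rewrite !size_cat size_mkseq => /addIn.
rewrite hvz size_rcons {1 4}vE (open_closedP d_gt0 lim) (closed_openP d_gt0 lim).
split; split.
- move=> [n n0 vn]; exists n; split=> //; apply/of_word_std_uP.
  by rewrite (std_square d_gt0 lim n0); apply/prefE.
- move=> [n [n0 /of_word_std_uP]].
  by rewrite (std_square d_gt0 lim n0) => /prefE; exists n.
- move=> [n vn]; exists n; split; last exact: u_near_comm.
  apply/of_word_std_uP; rewrite (std_central d_gt0 lim n).1 lxS lyS.
  exact/prefE.
- move=> [n [/of_word_std_uP]].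
  by rewrite (std_central d_gt0 lim n).1 lxS lyS => /prefE; exists n.
Qed.
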